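(* Let $K$ be a field of characteristic zero, $n\geq 3$, and let $H$ be a polynomial map over $K$ of the form $$H=(H_1(x_1,x_2,\ldots,x_n),\,H_2(x_2,\ldots,x_n),\,H_3(x_1,x_2),\ldots,H_n(x_1,x_2)),$$ where $H(0)=0$, $H_1\in K[x_1,\ldots,x_n]$, $H_3,\ldots,H_n\in K[x_1,x_2]$, and $H_2(x_2,\ldots,x_n)=b_3x_3+\cdots+b_nx_n+H_2^{(0)}(x_2)$ with $b_3,\ldots,b_n\in K$ and $H_2^{(0)}\in K[x_2]$. Let $F=x+H$, i.e. $F=(x_1+H_1,\ldots,x_n+H_n)$. If $JH$ is nilpotent and the components $H_1,\ldots,H_n$ of $H$ are linearly independent over $K$, then $F$ is tame.
   Context: $JH=(\partial H_i/\partial x_j)_{n\times n}$ is the Jacobian matrix of $H$. A polynomial map $K^n\to K^n$ of the form $(x_1,\ldots,x_{i-1},x_i+Q,x_{i+1},\ldots,x_n)$ is called elementary if $Q\in K[x_1,\ldots,x_{i-1},x_{i+1},\ldots,x_n]$. A polynomial map is called tame if it is a finite composition of invertible linear maps and elementary maps. *)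

(* Defs.v *)
From mathcomp Require Import all_boot all_order all_algebra.
From mathcomp.multinomials Require Export mpoly.

Set Implicit Arguments.
Unset Strict Implicit.
Unset Printing Implicit Defensive.

Import GRing.Theory.
Local Open Scope ring_scope.

(* p \in K[x_i : i \in S] *)
Definition in_vars (K : fieldType) (n : nat) (S : {set 'I_n})
    (p : {mpoly K[n]}) : Prop :=
  forall m, m \in msupp p -> forall i, m i != 0%N -> i \in S.

Definition polymap (K : fieldType) (n : nat) : Type := n.-tuple {mpoly K[n]}.

Section PolyMap.
Variables (K : fieldType) (n : nat).
Implicit Types (F G H : polymap K n) (s : seq (polymap K n)).

Definition polymap_id : polymap K n := [tuple 'X_i | i < n].

Definition polymap_add F G : polymap K n := [tuple tnth F i + tnth G i | i < n].

(* F o G, that is, x |-> F (G x) *)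
Definition polymap_comp F G : polymap K n :=
  [tuple comp_mpoly G (tnth F i) | i < n].

Definition jacobian H : 'M[{mpoly K[n]}]_n :=
  \matrix_(i, j) (tnth H i)^`M(j).

Definition linear_map (A : 'M[K]_n) : polymap K n :=
  [tuple \sum_j A i j *: 'X_j | i < n].

Definition invertible_linear F : Prop :=
  exists2 A : 'M[K]_n, A \in unitmx & F = linear_map A.

Definition elementary F : Prop :=
  exists i : 'I_n, exists2 Q : {mpoly K[n]}, in_vars [set~ i] Q &
    F = [tuple if j == i then 'X_i + Q else 'X_j | j < n].

Definition tame F : Prop :=
  exists2 s, (forall G, G \in s -> invertible_linear G \/ elementary G)
           & F = foldr polymap_comp polymap_id s.

Definition lin_indep H : Prop :=
  forall c : 'I_n -> K, \sum_i c i *: tnth H i = 0 -> forall i, c i = 0.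

End PolyMap.

Definition nilpotent_mx (R : comNzRingType) (n : nat) (A : 'M[R]_n) : Prop :=
  exists k : nat, A ^+ k = 0.

(* Main.v *)
From HB Require Import structures.
Require Import Defs.
From mathcomp Require Import all_boot all_order all_algebra.
From mathcomp Require Import ring.

(** Why the theorem holds. Write D_k for the derivative in x_k, z for the
    variables x_3, ..., x_n, put f = D_2 H_2, which is a polynomial in x_2
    alone, and L = b_3 H_3 + ... + b_n H_n, a polynomial in x_1 and x_2.

    The block of JH with both indices at least 3 vanishes. So the determinant
    of 1 - t JH, which is 1 because JH is nilpotent over a domain, is a 2 x 2
    determinant of degree 4 in t, and its coefficients give four equations
    ([nilpotent_arrow_eqs]). With a = D_2 H_1 and with p, q the sums of
    D_j H_1 * D_1 H_j and of D_j H_1 * D_2 H_j over j >= 3, they read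
      D_1 H_1 = - f,                 p = - f^2 - D_2 L,
      a D_1 L = - f (f^2 + 2 D_2 L), p D_2 L = q D_1 L.

    If D_1 L = 0, the equations force f = 0 and D_2 L = 0, so L = 0, then b = 0
    and H_2 = 0, against linear independence. So D_1 L <> 0, and dividing by it
    shows that a, p and q do not involve z. As the H_j with j >= 3 are linearly
    independent and involve x_1 and x_2 only, this forces the D_j H_1 to be
    constants c_j ([separated_relation]). Hence p and q are the partial
    derivatives of P = c_3 H_3 + ... + c_n H_n, and what remains is a system in
    the plane for f, a, L and P.

    - If f <> 0, then D_1 L divides f^6, so it depends on x_2 only; comparing
      mixed derivatives then gives r r'' = 2 r'^2 for r = D_1 L, whence r, and
      then f, a and all partial derivatives of L and P, are constant
      ([plane_system_rigid]).
    - If f = 0, the system says that the Jacobian matrix of (P, L) is nilpotent.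
      Then the level curves of L are straight lines, so L is constant along
      the lines in direction (- D_2 L, D_1 L) ([on_level_line]). The leading
      coefficient along such a line is the top homogeneous part of L evaluated
      at the direction; as it vanishes, the slope D_2 L / D_1 L is algebraic
      over K, thus an element of K ([proportional_partials]).

    In both cases there are constants k, k' such that N = (H_2 - b.z) - L is a
    polynomial in x_1 + k x_2 and F factors into maps each of which adds to some
    variables polynomials in the others ([tame_of_shears]):
      z   += H_z(x_1, x_2);   x_1 += k x_2;   x_2 += N;   x_1 += k' x_2;
      (x_1, x_2) += (c.z, b.z). *)

Set Implicit Arguments.
Unset Strict Implicit.
Unset Printing Implicit Defensive.

Import GRing.Theory.
Local Open Scope ring_scope.

(** * Polynomials restricted to lines *)

(** Reduces x = y, given u = v, to an identity that [ring] can check. *)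
Lemma eq_from_sub (V : zmodType) (x y u v : V) : x - y = u - v -> u = v -> x = y.
Proof. by move=> + uv; rewrite uv subrr => /eqP; rewrite subr_eq0 => /eqP. Qed.

Lemma mderiv_nat (K : fieldType) n k (i : 'I_n) : (k%:R : {mpoly K[n]})^`M(i) = 0.
Proof. by rewrite -mpolyC_nat mderivC. Qed.

Lemma mderivXU (K : fieldType) n (i k : 'I_n) : ('X_i : {mpoly K[n]})^`M(k) = (i == k)%:R.
Proof.
rewrite mderivX mnm1E; case: eqP => [->|_]; last by rewrite scale0r.
by rewrite scale1r -{1}[U_(k)%MM]add0m addmK mpolyX0.
Qed.

(** Used with [deriv] for restrictions to lines and with a partial derivative
    for changes of coordinates. *)
Lemma mmap_chain_rule (K : fieldType) (n : nat) (B : comNzRingType)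
    (f : {rmorphism K -> B}) (g : 'I_n -> B) (d : {additive B -> B}) :
    (forall x y, d (x * y) = d x * y + x * d y) ->
    (forall c, d (f c) = 0) ->
  forall p, d (mmap f g p) = \sum_i mmap f g p^`M(i) * d (g i).
Proof.
move=> dM df.
pose P p := d (mmap f g p) = \sum_i mmap f g p^`M(i) * d (g i).
have P1 : P 1.
  rewrite /P -mpolyC1 mmapC df big1 // => i _.
  by rewrite mderivC mmap0 mul0r.
have PM p q : P p -> P q -> P (p * q).
  rewrite /P => Pp Pq; rewrite rmorphM dM Pp Pq mulr_suml mulr_sumr -big_split.
  by apply: eq_bigr => i _; rewrite mderivM rmorphD !rmorphM /=; ring.
have PX i : P 'X_i.
  rewrite /P mmapX mmap1U (bigD1 i) //= big1 ?addr0 => [|j ji].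
    by rewrite mderivXU eqxx rmorph1 mul1r.
  by rewrite mderivXU eq_sym (negPf ji) mmap0 mul0r.
have PXm m : P 'X_[m].
  rewrite mpolyXE_id; apply: (big_ind P) => // i _.
  by elim: (m i) => [|k IH]; rewrite ?expr0 // exprS; apply: PM.
elim/mpolyind => [|c m p _ _ Pp].
  by rewrite mmap0 raddf0 big1 // => i _; rewrite mderiv0 mmap0 mul0r.
rewrite !raddfD /= mmapZ dM df mul0r add0r PXm Pp mulr_sumr -big_split /=.
by apply: eq_bigr => i _; rewrite mderivD mderivZ rmorphD /= mmapZ; ring.
Qed.

Lemma coefM_top (A : nzSemiRingType) (p q : {poly A}) j k :
  (size p <= j.+1)%N -> (size q <= k.+1)%N -> (p * q)`_(j + k) = p`_j * q`_k.
Proof.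
move=> szp szq; rewrite coefM (bigD1 (inord j)) //= inordK ?ltnS ?leq_addr // addKn.
rewrite big1 ?addr0 // => i ij.
have := ltn_ord i; rewrite ltnS => le_i.
case: (ltngtP i j) => [lt|gt|eq].
- by rewrite [q`__]nth_default ?mulr0 // (leq_trans szq) // ltn_subRL ltn_add2r.
- by rewrite nth_default ?mul0r // (leq_trans szp).
by case/eqP: ij; apply: val_inj; rewrite /= inordK ?ltnS ?leq_addr.
Qed.

Section Line.
Variables (K : fieldType) (n : nat) (A : comNzRingType) (f : {rmorphism K -> A}).
Variables (a v : 'I_n -> A).

(** The polynomial p(a + T v) in T. With A = K this is restriction to a line of
    the affine space; with A the polynomial ring itself and a the generic point,
    the direction v may depend on the point. *)
Definition on_line (p : {mpoly K[n]}) : {poly A} :=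
  mmap (polyC \o f) (fun i => (a i)%:P + (v i)%:P * 'X) p.

HB.instance Definition _ := GRing.RMorphism.copy on_line
  (mmap (polyC \o f) (fun i => (a i)%:P + (v i)%:P * 'X)).

Lemma horner_on_line p t : (on_line p).[t] = mmap f (fun i => a i + v i * t) p.
Proof.
rewrite /on_line /mmap horner_sum; apply: eq_bigr => m _.
rewrite hornerM /= hornerC /mmap1 horner_prod; congr (_ * _).
by apply: eq_bigr => i _; rewrite !hornerE.
Qed.

Lemma deriv_on_line p : (on_line p)^`() = \sum_i on_line p^`M(i) * (v i)%:P.
Proof.
rewrite /on_line (@mmap_chain_rule _ _ _ _ _ (@deriv A)) => [|x y|c].
- by apply: eq_bigr => i _; rewrite /= derivD derivM !derivC derivX mul0r !add0r mulr1.
- by rewrite /= derivM.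
- by rewrite /= derivC.
Qed.

Lemma size_linear_exp (x y : A) (k : nat) :
  (size ((x%:P + y%:P * 'X) ^+ k) <= k.+1)%N /\
  ((x%:P + y%:P * 'X) ^+ k)`_k = y ^+ k.
Proof.
elim: k => [|k]; first by rewrite !expr0 size_poly1 coefC.
set p := _ ^+ k => -[szk ck].
rewrite !exprSr -/p mulrDr; split.
  rewrite (leq_trans (size_polyD _ _)) // geq_max; apply/andP; split.
    by rewrite mulrC mul_polyC (leq_trans (size_scale_leq _ _)) // ltnW.
  rewrite mulrA [_ * y%:P]mulrC mul_polyC -scalerAl.
  by rewrite (leq_trans (size_scale_leq _ _)) // (leq_trans (size_polyMleq _ _)) // size_polyX addn2.
rewrite coefD coefMC nth_default // mul0r add0r mulrA coefMX /= coefMC ck.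
by [].
Qed.

Lemma coef_on_line_monomial (m : 'X_{1..n}) :
  let q := mmap1 (fun i => (a i)%:P + (v i)%:P * 'X) m in
  (size q <= (mdeg m).+1)%N /\ q`_(mdeg m) = mmap1 v m.
Proof.
rewrite /mmap1 mdegE.
pose Q (p : {poly A}) (k : nat) (y : A) := (size p <= k.+1)%N /\ p`_k = y.
apply: (big_rec3 (fun k p y => Q p k y)) => [|i k p y _ [szp cp]].
  by split; rewrite ?size_poly1 ?coefC.
have [szq cq] := size_linear_exp (a i) (v i) (m i); split.
  rewrite (leq_trans (size_polyMleq _ _)) //.
  by have := leq_add szq szp; rewrite addSn addnS; case: (_ + _)%N.
by rewrite coefM_top // cq cp.
Qed.

(** Along a line only the monomials of top degree N reach T^N, and each
    contributes its value at the direction v. *)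
Lemma coef_on_line_top p N : (msize p <= N.+1)%N ->
  (on_line p)`_N = \sum_(m <- msupp p | mdeg m == N) f p@_m * mmap1 v m.
Proof.
move=> szp; rewrite /on_line /mmap coef_sum [RHS]big_mkcond /= !big_seq.
apply: eq_bigr => m mp; rewrite coefCM.
have [szm cm] := coef_on_line_monomial m.
have: (mdeg m <= N)%N by rewrite -ltnS (leq_trans (msize_mdeg_lt mp)).
rewrite leq_eqVlt => /predU1P[mN|mN]; first by rewrite -mN eqxx cm.
by rewrite (ltn_eqF mN) nth_default ?mulr0 // (leq_trans szm).
Qed.
End Line.

Lemma on_line_at0 (K : fieldType) n v (p : {mpoly K[n]}) :
  (on_line (@mpolyC n K) (fun i => 'X_i) v p).[0] = p.
Proof.
rewrite horner_on_line -[RHS]comp_mpoly_id /comp_mpoly.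
rewrite /mmap; apply: eq_bigr => m _; congr (_ * _); apply: mmap1_eq => i.
by rewrite mulr0 addr0 tnth_mktuple.
Qed.

(** * Univariate differential equations in characteristic zero *)

Lemma deriv_eq0_polyC (A : idomainType) (P : {poly A}) :
  [pchar A] =i pred0 -> P^`() = 0 -> P = (P`_0)%:P.
Proof.
move=> /pcharf0P A0 dP; apply/polyP => -[|k]; rewrite coefC //=.
have: P^`()`_k = 0 by rewrite dP coef0.
rewrite coef_deriv => /eqP.
by rewrite -mulr_natr mulf_eq0 A0 /= orbF => /eqP.
Qed.

(** The equation says that 1/P has zero second derivative. If P
    had degree e >= 2, the leading coefficients would give e (e - 1) = 2 e^2;
    and if P has degree 1, the left side is zero, so P' is. *)
Lemma poly_deriv_square (A : idomainType) (P : {poly A}) :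
  [pchar A] =i pred0 -> P * P^`()^`() = 2%:R * P^`() ^+ 2 -> P^`() = 0.
Proof.
move=> /pcharf0P A0 eqP2; apply/eqP/negPn/negP => dP0.
have d2P0 : P^`()^`() != 0.
  apply: contra_neq dP0 => d2P0; move/esym/eqP: eqP2; rewrite d2P0 mulr0.
  by rewrite -polyC_natr mul_polyC scale_poly_eq0 A0 /= sqrf_eq0 => /eqP.
have [e szP] : exists e, size P = e.+3.
  have: (2 < size P)%N.
    rewrite ltnNge; apply: contra d2P0 => le2.
    apply/eqP/polyP => j; rewrite !coef_deriv nth_default ?mul0rn ?coef0 //.
    exact: leq_trans le2 _.
  by case: (size P) => [|[|[|e]]] // _; exists e.
have lc0 : P`_e.+2 != 0.
  by rewrite -[e.+2]/(e.+3.-1) -szP lead_coef_eq0 -size_poly_eq0 szP.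
have szP1 : (size P^`() <= e.+2)%N.
  by apply/leq_sizeP => j le; rewrite coef_deriv nth_default ?mul0rn // szP ltnS.
have szP2 : (size P^`()^`() <= e.+1)%N.
  apply/leq_sizeP => j le; rewrite coef_deriv nth_default ?mul0rn //.
  by rewrite (leq_trans szP1).
have eq_top : P`_e.+2 ^+ 2 * (e.+2%:R * e.+3%:R) = 0.
  have: (P * P^`()^`())`_(e.+2 + e) = (2%:R * P^`() ^+ 2)`_(e.+1 + e.+1).
    by rewrite eqP2 addSnnS.
  rewrite coefM_top ?szP // -polyC_natr coefCM expr2 coefM_top //.
  have -> : P^`()^`()`_e = P`_e.+2 * e.+2%:R * e.+1%:R by rewrite !coef_deriv !mulr_natr.
  have -> : P^`()`_e.+1 = P`_e.+2 * e.+2%:R by rewrite coef_deriv mulr_natr.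
  move=> E; have -> : e.+3%:R = 2%:R * e.+2%:R - e.+1%:R :> A.
    by rewrite -[e.+3]addn3 -[e.+2]addn2 -[e.+1]addn1 !natrD; ring.
  move: E; set x := P`_e.+2; set y := e.+2%:R; set z := e.+1%:R => E.
  have -> : x ^+ 2 * (y * (2%:R * y - z)) = 2%:R * (x * y * (x * y)) - x * (x * y * z) by ring.
  by rewrite -E subrr.
by move/eqP: eq_top; rewrite !mulf_eq0 (negPf lc0) !A0.
Qed.

(** The first nonzero coefficient of y, of index k + 1 say, would give a nonzero
    coefficient of index k on the left, while the right side starts at index k + 1. *)
Lemma poly_linear_ode (A : idomainType) (a b y : {poly A}) :
  [pchar A] =i pred0 -> a`_0 != 0 -> y`_0 = 0 -> a * y^`() = b * y -> y = 0.
Proof.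
move=> /pcharf0P A0 a0 y0 ode.
have y_lt k : forall j, (j <= k)%N -> y`_j = 0.
  elim: k => [|k IH] j; first by rewrite leqn0 => /eqP ->.
  rewrite leq_eqVlt => /predU1P[->|]; last exact: IH.
  have : (a * y^`())`_k = (b * y)`_k by rewrite ode.
  rewrite !coefM [RHS]big1 => [|j' _]; last by rewrite (IH _ (leq_subr _ _)) mulr0.
  rewrite big_ord_recl big1 => [|j' _]; last first.
    by rewrite coef_deriv IH ?mul0rn ?mulr0 //= /bump /= add1n subnSK // leq_subr.
  rewrite /= subn0 addr0 coef_deriv -mulr_natr => /eqP.
  by rewrite !mulf_eq0 (negPf a0) A0 /= orbF => /eqP.
by apply/polyP => k; rewrite coef0 (y_lt k).
Qed.

(** * Derivatives of multivariate polynomials in characteristic zero *)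

Lemma in_vars_mderiv (K : fieldType) n (S : {set 'I_n}) (p : {mpoly K[n]}) k :
  in_vars S p -> k \notin S -> p^`M(k) = 0.
Proof.
move=> pS kS; rewrite /mderiv big_seq big1 // => m mp.
by have [->|/(pS m mp)] := eqVneq (m k) 0%N; [rewrite mul0r scale0r | rewrite (negPf kS)].
Qed.

Section CharZero.
Variables (K : fieldType) (n : nat).
Hypothesis charK0 : [pchar K] =i pred0.
Implicit Types (p q r u w : {mpoly K[n]}).

Let mpoly_char0 : [pchar {mpoly K[n]}] =i pred0.
Proof. by move=> k; rewrite (pchar_lalg {mpoly K[n]}). Qed.

Let natr_eq0K k : (k%:R == 0 :> K) = (k == 0%N).
Proof. exact: (iffLR (pcharf0P K) charK0). Qed.

Lemma mderiv_eq0 i p :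
  p^`M(i) = 0 <-> (forall m, m \in msupp p -> m i = 0%N).
Proof.
split=> [Dp m mp | mi0].
  apply/eqP/negPn/negP => mi; case/negP: mp.
  have le : (U_(i) <= m)%MM.
    by apply/mnm_lepP => j; rewrite mnm1E; case: eqP => // <-; rewrite lt0n.
  have /(congr1 (mcoeff (m - U_(i))%MM)) := Dp.
  rewrite mcoeff_mderiv submK // mcoeff0 => /eqP.
  by rewrite -mulr_natr mulf_eq0 natr_eq0K /= orbF mcoeff_eq0 => /negP.
rewrite /mderiv big_seq big1 => [//|m mp].
by rewrite (mi0 m mp) mul0r scale0r.
Qed.

Lemma in_varsP (S : {set 'I_n}) p :
  in_vars S p <-> (forall i, i \notin S -> p^`M(i) = 0).
Proof.
split=> [pS i iS | Dp m mp i].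
  by apply/mderiv_eq0 => m mp; apply/eqP; apply: contraNT iS; apply: pS mp i.
by apply: contraNT => iS; apply/eqP; apply: (iffLR (mderiv_eq0 i p)) => //; apply: Dp.
Qed.

Lemma mderiv_eq0_const p : (forall i, p^`M(i) = 0) -> p = (p.@[fun=> 0])%:MP.
Proof.
move=> Dp; suff [c ->] : exists c, p = c%:MP by rewrite mevalC.
exists p@_0; apply/mpolyP => m; rewrite mcoeffC.
have [->|m0] := eqVneq m 0%MM; first by rewrite mulr1.
rewrite mulr0; apply/eqP; rewrite mcoeff_eq0; apply: contra m0 => mp.
by apply/eqP/mnmP => i; rewrite mnm0E; apply: (iffLR (mderiv_eq0 i p)).
Qed.

Lemma eq_mderiv p q : (forall i, p^`M(i) = q^`M(i)) ->
  p.@[fun=> 0] = q.@[fun=> 0] -> p = q.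
Proof.
move=> eqD eq0; apply/eqP; rewrite -subr_eq0 (mderiv_eq0_const (p := p - q)).
  by rewrite mevalB eq0 subrr.
by move=> i; rewrite mderivB eqD subrr.
Qed.

Lemma msize_mderiv i p k : (msize p <= k.+1)%N -> (msize p^`M(i) <= k)%N.
Proof.
move=> szp; rewrite msizeE big_seq; elim/big_ind: _ => // [x y|m mp].
  by rewrite geq_max => -> ->.
have : (m + U_(i))%MM \in msupp p.
  apply: contraLR mp => /memN_msupp_eq0 p0.
  by rewrite -mcoeff_eq0 mcoeff_mderiv p0 mul0rn.
by move=> /msize_mdeg_lt; rewrite mdegD mdeg1 addn1 => /leq_trans/(_ szp).
Qed.

Lemma poly_nonroot (P : {poly K}) : P != 0 -> exists t, P.[t] != 0.
Proof.
move=> P0; pose rs := [seq k%:R : K | k <- iota 0 (size P)].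
have rs_uniq : uniq rs.
  rewrite map_inj_uniq ?iota_uniq // => j k.
  wlog le : j k / (j <= k)%N => [IH|] eq_jk.
    by case/orP: (leq_total j k) => /IH; [apply | move=> /(_ (esym eq_jk))].
  apply/eqP; rewrite eqn_leq le /= -subn_eq0 -natr_eq0K.
  by rewrite natrB // eq_jk subrr.
have: ~~ all (root P) rs.
  apply/negP => rts; have := max_poly_roots P0 rts rs_uniq.
  by rewrite size_map size_iota ltnn.
by case/allPn => t _ Pt; exists t.
Qed.

(** Induction on the size: if some derivative is nonzero, it has a nonzero value
    somewhere, so the polynomial is not identically zero on the parallel to the
    corresponding axis through that point. *)
Lemma meval_neq0 p : p != 0 -> exists z, p.@[z] != 0.
Proof.
move: {2}(msize p) (leqnn (msize p)) => k; elim: k p => [|k IH] p szp p0.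
  by move: szp; rewrite leqn0 msize_poly_eq0 (negPf p0).
have [/existsP[i Dp0]|/existsPn Dp0] := boolP [exists i, p^`M(i) != 0]; last first.
  exists (fun=> 0); apply: contraNneq p0 => pz.
  rewrite (mderiv_eq0_const (p := p)) ?pz // => i.
  by have /negPn/eqP := Dp0 i.
have [z Dpz] := IH _ (msize_mderiv i szp) Dp0.
pose e j : K := (i == j)%:R.
have [|t pt] := @poly_nonroot (on_line idfun z e p).
  apply: contraNneq Dpz => lp0.
  have := deriv_on_line idfun z e p; rewrite lp0 deriv0 (bigD1 i) //= big1 => [|j ji].
    rewrite addr0 /e eqxx mulr1 => /(congr1 (horner^~ 0)).
    rewrite horner0 horner_on_line => {1}->; apply/eqP/meval_eq => j /=.
    by rewrite mulr0 addr0.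
  by rewrite /e eq_sym (negPf ji) mulr0.
by exists (fun j => z j + e j * t); rewrite horner_on_line in pt.
Qed.

Let e (i : 'I_n) : 'I_n -> {mpoly K[n]} := fun j => (i == j)%:R.

Lemma deriv_on_axis i p :
  (on_line (@mpolyC n K) (fun j => 'X_j) (e i) p)^`()
    = on_line (@mpolyC n K) (fun j => 'X_j) (e i) p^`M(i).
Proof.
rewrite deriv_on_line (bigD1 i) //= big1 => [|j ji]; first by rewrite /e eqxx mulr1 addr0.
by rewrite /e eq_sym (negPf ji) mulr0.
Qed.

(** The kernel of a partial derivative is factorially closed. Translation by T
    along the axis turns it into the constants among polynomials in T, and a
    factor of a nonzero constant is constant. *)
Lemma mderiv_factor i u w q : u * w = q -> q != 0 -> q^`M(i) = 0 -> u^`M(i) = 0.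
Proof.
move=> uw q0 Dq; pose phi := on_line (@mpolyC n K) (fun j => 'X_j) (e i).
have phi_inj p : phi p = 0 -> p = 0.
  by move=> pp; rewrite -(on_line_at0 (e i) p) -/phi pp horner0.
have phiq : phi q = ((phi q)`_0)%:P.
  by apply: deriv_eq0_polyC => //; rewrite deriv_on_axis Dq rmorph0.
have : size (phi q) == 1%N.
  rewrite phiq size_polyC; suff -> : (phi q)`_0 != 0 by [].
  apply: contra_neq q0 => q0'; apply: phi_inj.
  by rewrite phiq q0' polyC0.
rewrite -uw /phi rmorphM size_mul_eq1 => /andP[/eqP sz1 _].
apply: phi_inj; rewrite /phi -deriv_on_axis.
by rewrite (@size1_polyC _ (on_line _ _ _ u)) ?derivC // sz1.
Qed.

Lemma mderiv_square i r :
  r * r^`M(i)^`M(i) = 2%:R * r^`M(i) ^+ 2 -> r^`M(i) = 0.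
Proof.
move=> eq2; rewrite -(on_line_at0 (e i) r^`M(i)) -deriv_on_axis.
rewrite poly_deriv_square ?horner0 //.
by rewrite !deriv_on_axis -!rmorphM eq2 rmorphM rmorphXn rmorph_nat.
Qed.

Lemma mderiv_linear_form (Z : {set 'I_n}) (d : 'I_n -> K) k :
  (\sum_(j in Z) d j *: 'X_j : {mpoly K[n]})^`M(k) = if k \in Z then (d k)%:MP else 0.
Proof.
rewrite raddf_sum /=; case: ifP => kZ.
  rewrite (bigD1 k) //= big1 ?addr0 => [|j /andP[_ jk]].
    by rewrite mderivZ mderivXU eqxx -mul_mpolyC mulr1.
  by rewrite mderivZ mderivXU (negPf jk) scaler0.
rewrite big1 // => j jZ; rewrite mderivZ mderivXU.
by case: eqP kZ => [<-|_ _]; rewrite ?jZ ?scaler0.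
Qed.

Lemma in_vars_lincomb (Z V : {set 'I_n}) (d : 'I_n -> K) (G : 'I_n -> {mpoly K[n]}) :
  (forall j, j \in Z -> in_vars V (G j)) -> in_vars V (\sum_(j in Z) d j *: G j).
Proof.
move=> GV; apply/in_varsP => k kV; rewrite raddf_sum big1 // => j jZ /=.
by rewrite mderivZ (in_vars_mderiv (GV j jZ) kV) scaler0.
Qed.

Lemma meval0_lincomb (Z : {set 'I_n}) (d : 'I_n -> K) (G : 'I_n -> {mpoly K[n]}) z :
  (forall j, j \in Z -> (G j).@[z] = 0) -> (\sum_(j in Z) d j *: G j).@[z] = 0.
Proof.
by move=> G0; rewrite raddf_sum big1 // => j jZ /=; rewrite mevalZ G0 ?mulr0.
Qed.
End CharZero.

Section SeparatedRelation.
Variables (K : fieldType) (n : nat).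
Hypothesis charK0 : [pchar K] =i pred0.

(** A linear relation between the gradients of the G_i in the V-variables, with
    coefficients h_i in the other variables, is trivial as soon as the G_i are
    linearly independent and vanish at 0. Differentiating the relation in a
    variable outside V gives a relation with coefficients of smaller degree, so
    by induction the h_i are constants; integrating then gives a linear relation
    between the G_i themselves. *)
Lemma separated_relation (I : finType) (P : pred I) (V : {set 'I_n})
    (G h : I -> {mpoly K[n]}) :
    (forall i, P i -> in_vars V (G i)) ->
    (forall i, P i -> (G i).@[fun=> 0] = 0) ->
    (forall c : I -> K, \sum_(i | P i) c i *: G i = 0 -> forall i, P i -> c i = 0) ->
    (forall i, P i -> in_vars (~: V) (h i)) ->
    (forall k, k \in V -> \sum_(i | P i) h i * (G i)^`M(k) = 0) ->
  forall i, P i -> h i = 0.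
Proof.
move=> GV G0 Gfree hV.
have DG i k : P i -> k \notin V -> (G i)^`M(k) = 0.
  by move=> Pi; apply: (iffLR (in_varsP charK0 V (G i)) (GV i Pi)).
have {hV} Dh i k : P i -> k \in V -> (h i)^`M(k) = 0.
  by move=> Pi kV; apply: (iffLR (in_varsP charK0 _ (h i)) (hV i Pi)); rewrite inE kV.
have [d szh] : exists d, forall i, P i -> (msize (h i) <= d)%N.
  by exists (\max_i msize (h i)) => i _; apply: leq_bigmax.
elim: d h Dh szh => [|d IH] h Dh szh rel i Pi.
  by apply/eqP; rewrite -msize_poly_eq0 -leqn0 szh.
have Dh0 j k : P j -> (h j)^`M(k) = 0.
  have [kV Pj|kV] := boolP (k \in V); first exact: Dh.
  apply: (IH (fun j => (h j)^`M(k))) => [j' l Pj' lV|j' Pj'|l lV].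
  - by rewrite mderiv_comm Dh // mderiv0.
  - exact/msize_mderiv/szh.
  - have := congr1 (mderiv k) (rel l lV); rewrite mderiv0; apply: etrans.
    rewrite raddf_sum; apply: eq_bigr => j' Pj' /=.
    by rewrite mderivM [(G j')^`M(l)^`M(k)]mderiv_comm (DG j' k) // mderiv0 mulr0 addr0.
have hC j : P j -> h j = ((h j).@[fun=> 0])%:MP.
  by move=> Pj; apply: (mderiv_eq0_const charK0) => k; apply: Dh0.
rewrite hC // (Gfree (fun j => (h j).@[fun=> 0])) ?mpolyC0 //.
apply: (eq_mderiv charK0) => [k|]; last first.
  by rewrite meval0 raddf_sum big1 // => j Pj /=; rewrite mevalZ G0 ?mulr0.
rewrite mderiv0 raddf_sum /=; have [kV|kV] := boolP (k \in V); last first.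
  by rewrite big1 // => j Pj; rewrite mderivZ DG ?scaler0.
by apply: etrans (rel k kV); apply: eq_bigr => j Pj; rewrite mderivZ -mul_mpolyC -hC.
Qed.
End SeparatedRelation.

(** * Plane polynomials whose level curves are lines *)

Section Homogenize.
Variables (K : fieldType) (n : nat).
Hypothesis charK0 : [pchar K] =i pred0.
Variables (u w : {mpoly K[n]}).

(** For q of degree at most N, the denominator-free form w^N q(u / w). *)
Definition homogenize (N : nat) (q : {poly K}) : {mpoly K[n]} :=
  \sum_(k < N.+1) q`_k *: (u ^+ k * w ^+ (N - k)).

Lemma homogenize_factor N (q : {poly K}) c : (size q <= N.+1)%N ->
  homogenize N.+1 (q * ('X - c%:P)) = homogenize N q * (u - c *: w).
Proof.
move=> szq; rewrite /homogenize mulr_suml.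
pose F k := q`_k.-1 *+ (0 < k)%N *: (u ^+ k * w ^+ (N.+1 - k)).
pose G k := q`_k *: (u ^+ k * w ^+ (N.+1 - k)).
rewrite (eq_bigr (fun k : 'I_N.+2 => F k - c *: G k)) => [|k _]; last first.
  rewrite mulrBr coefB coefMX coefMC /F /G scalerBl scalerA [q`_k * c]mulrC.
  by case: (k : nat) => [|m] /=; rewrite ?mulr0n ?mulr1n.
rewrite sumrB -scaler_sumr big_ord_recl {1}/F scale0r add0r.
rewrite [\sum_(k < N.+2) G k]big_ord_recr /= {2}/G nth_default // scale0r addr0.
rewrite scaler_sumr -sumrB; apply: eq_bigr => k _; rewrite /F /G /= /bump /= add1n subSS.
rewrite subSn -1?ltnS // mulrBr !exprS -!mul_mpolyC; ring.
Qed.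

Lemma meval_homogenize N (q : {poly K}) z : w.@[z] != 0 -> (size q <= N.+1)%N ->
  (homogenize N q).@[z] = w.@[z] ^+ N * q.[u.@[z] / w.@[z]].
Proof.
move=> wz szq; rewrite (horner_coef_wide _ szq) mulr_sumr raddf_sum /=.
apply: eq_bigr => k _; rewrite mevalZ mevalM !rmorphXn /= expr_div_n.
have le : (k <= N)%N by rewrite -ltnS.
have -> : w.@[z] ^+ N = w.@[z] ^+ (N - k) * w.@[z] ^+ k by rewrite -exprD subnK.
field.
by rewrite expf_eq0 (negPf wz) andbF.
Qed.

(** A fraction u / w that is algebraic over K is constant. Its value c at a point
    where w does not vanish lies in K and is a root of q, so either u = c w or
    the factor X - c can be removed from q. *)
Lemma proportional_of_homogenize N (q : {poly K}) :
    w != 0 -> q != 0 -> (size q <= N.+1)%N -> homogenize N q = 0 ->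
  exists c, u = c *: w.
Proof.
move=> /(meval_neq0 charK0)[z wz]; elim: N q => [|N IH] q q0 szq hq.
  have := meval_homogenize wz szq; rewrite hq meval0 expr0 mul1r => /esym/eqP.
  have /size1_polyC qC := szq; rewrite qC hornerC -(polyC_eq0 q`_0) -qC.
  by rewrite (negPf q0).
have := meval_homogenize wz szq; rewrite hq meval0 => /esym/eqP.
rewrite mulf_eq0 expf_eq0 (negPf wz) /= => /factor_theorem[r qE].
have r0 : r != 0 by apply: contraNneq q0 => r0; rewrite qE r0 mul0r.
have szr : (size r <= N.+1)%N by move: szq; rewrite qE size_Mmonic ?monicXsubC // size_XsubC addn2.
move/eqP: hq; rewrite qE homogenize_factor // mulf_eq0 => /orP[/eqP/(IH _ r0 szr)//|].
by rewrite subr_eq0 => /eqP ->; exists (u.@[z] / w.@[z]).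
Qed.
End Homogenize.

(** In the application, P1 and P2 are the partial derivatives of L restricted to
    the line through the generic point in direction (- c2, c1), where c1 and c2
    are the partial derivatives at that point. Their failure y to stay
    proportional to (c1, c2) solves a homogeneous linear equation with zero
    initial value. *)
Lemma flat_ode (A : idomainType) (P1 P2 h11 h12 h22 : {poly A}) (c1 c2 : A) :
    [pchar A] =i pred0 -> P1`_0 = c1 -> P2`_0 = c2 -> c1 != 0 ->
    P1^`() = h12 * c1%:P - h11 * c2%:P -> P2^`() = h22 * c1%:P - h12 * c2%:P ->
    P1 * P1 * h22 - 2%:R * P1 * P2 * h12 + P2 * P2 * h11 = 0 ->
  P2 * c1%:P - P1 * c2%:P = 0.
Proof.
move=> char0 P1c P2c c1_neq0 dP1 dP2 flat; set y := _ - _.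
apply: (@poly_linear_ode _ (P1 ^+ 2)
  ((y - 2%:R * P2 * c1%:P) * h11 + 2%:R * P1 * c1%:P * h12)) => //.
- by rewrite -horner_coef0 horner_exp horner_coef0 P1c expf_neq0.
- by rewrite /y coefB !coefMC P1c P2c mulrC subrr.
have -> : y^`() = (h22 * c1%:P - h12 * c2%:P) * c1%:P - (h12 * c1%:P - h11 * c2%:P) * c2%:P.
  by rewrite /y derivB !derivM !derivC !mulr0 !addr0 dP1 dP2.
(* P1^2 y' is a quadratic form in P1 c1 and P1 c2; with P2 c1 - y for P1 c2 it
   becomes c1^2 times the left side of [flat] plus a multiple of y *)
apply/eqP; rewrite -subr_eq0; apply/eqP.
by rewrite -[RHS](mulr0 (c1%:P ^+ 2)) -flat /y; ring.
Qed.

Section LevelLines.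
Variables (K : fieldType) (n : nat).
Hypothesis charK0 : [pchar K] =i pred0.
Variables (i j : 'I_n) (L : {mpoly K[n]}).
Hypothesis ij : i != j.
Hypothesis L_vars : forall k, k != i -> k != j -> L^`M(k) = 0.
Let L1 := L^`M(i).
Let L2 := L^`M(j).
Hypothesis L1_neq0 : L1 != 0.
Hypothesis flat :
  L1 * L1 * L2^`M(j) - 2%:R * L1 * L2 * L1^`M(j) + L2 * L2 * L1^`M(i) = 0.

Let v k : {mpoly K[n]} := if k == i then - L2 else if k == j then L1 else 0.
Let phi := on_line (@mpolyC n K) (fun k => 'X_k) v.

Let deriv_phi p : (forall k, k != i -> k != j -> p^`M(k) = 0) ->
  (phi p)^`() = phi p^`M(j) * L1%:P - phi p^`M(i) * L2%:P.
Proof.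
move=> Dp; rewrite /phi deriv_on_line (bigD1 i) //= (bigD1 j) 1?eq_sym //= big1 => [|k /andP[ki kj]].
  have -> : (v i)%:P = - L2%:P by rewrite /v eqxx polyCN.
  have -> : v j = L1 by rewrite /v eq_sym (negPf ij) eqxx.
  move: (on_line _ _ _ p^`M(i)) (on_line _ _ _ p^`M(j)) => x y.
  move: (L1%:P) (L2%:P) => z t; ring.
by rewrite (Dp k) // rmorph0 mul0r.
Qed.

(** The hypothesis [flat] says that the level curves of L have zero curvature. *)
Lemma on_level_line : phi L = L%:P.
Proof.
have char0 : [pchar {mpoly K[n]}] =i pred0.
  by move=> k; rewrite (pchar_lalg {mpoly K[n]}).
have dL := deriv_phi L_vars.
have vars k l : k != i -> k != j -> L^`M(l)^`M(k) = 0.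
  by move=> ki kj; rewrite mderiv_comm L_vars // mderiv0.
have dL1 := deriv_phi (vars ^~ i).
have := deriv_phi (vars ^~ j); rewrite [L^`M(j)^`M(i)]mderiv_comm => dL2.
have phi0 p : (phi p)`_0 = p by rewrite -horner_coef0 on_line_at0.
have phi_flat : phi L1 * phi L1 * phi L2^`M(j) - 2%:R * phi L1 * phi L2 * phi L1^`M(j)
    + phi L2 * phi L2 * phi L1^`M(i) = 0.
  have := congr1 phi flat; rewrite /phi rmorph0 => <-.
  by rewrite rmorphD rmorphB !rmorphM rmorph_nat.
have dL0 := flat_ode char0 (phi0 L1) (phi0 L2) L1_neq0 dL1 dL2 phi_flat.
by rewrite (deriv_eq0_polyC char0 (etrans dL dL0)) phi0.
Qed.

(** The restriction of L to its level line is constant, so the coefficient of T^d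
    in it, with d the degree of L, vanishes. This coefficient is the top
    homogeneous part of L at the direction (- D_j L, D_i L), and it gives an
    algebraic equation over K for the slope. *)
Lemma proportional_partials : exists c, L2 = c *: L1.
Proof.
have [N szL] : exists N, msize L = N.+2.
  have: (1 < msize L)%N.
    rewrite ltnNge; apply: contra L1_neq0 => le1.
    by rewrite -msize_poly_eq0 -leqn0 (@msize_mderiv _ _ i L 0).
  by case: (msize L) => [|[|N]] // _; exists N.
have supp m k : m \in msupp L -> k != i -> k != j -> m k = 0%N.
  by move=> mL ki kj; apply: (iffLR (mderiv_eq0 charK0 k L)) mL; apply: L_vars.
have degE m : m \in msupp L -> mdeg m = (m i + m j)%N.
  move=> mL; rewrite mdegE (bigD1 i) //= (bigD1 j) 1?eq_sym //= big1 ?addn0 // => k.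
  by case/andP; apply: supp mL.
(* the top homogeneous part of L with x_i = X and x_j = 1 *)
pose q := \sum_(m <- msupp L | mdeg m == N.+1) L@_m *: 'X^(m i).
have coefq k : q`_k = \sum_(m <- msupp L | mdeg m == N.+1) L@_m * (k == m i)%:R.
  by rewrite coef_sum; apply: eq_bigr => m _; rewrite coefZ coefXn.
have szq : (size q <= N.+2)%N.
  apply/leq_sizeP => k le; rewrite coefq big_seq_cond big1 // => m /andP[mL /eqP dm].
  case: eqP => [km|]; last by rewrite mulr0.
  by move: le; rewrite km -dm (degE m mL) ltnNge leq_addr.
have q0 : q != 0.
  have L0 : L != 0 by rewrite -msize_poly_eq0 szL.
  have dm0 : mdeg (mlead L) = N.+1 by apply: succn_inj; rewrite mlead_deg.
  have m0L := mlead_supp L0.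
  apply: contraTneq m0L => q0; have := coefq (mlead L i); rewrite q0 coef0 mcoeff_msupp.
  rewrite big_mkcond (bigD1_seq (mlead L)) ?msupp_uniq ?mlead_supp //= dm0 !eqxx mulr1.
  rewrite big1_seq => [eq0|m /andP[m_neq mL]]; first by rewrite negbK -[L@__]addr0 -eq0.
  case: eqP => // dm; case: eqP => [eq_i|]; last by rewrite mulr0.
  case/eqP: m_neq; apply/mnmP => k.
  have [->|ki] := eqVneq k i; first by [].
  have [->|kj] := eqVneq k j; last by rewrite !supp ?mlead_supp.
  apply/eqP; rewrite -(eqn_add2l (m i)) -degE // -eq_i -degE ?mlead_supp //.
  by rewrite dm dm0.
suff hq : homogenize (- L2) L1 N.+1 q = 0.
  have [c /eqP] := proportional_of_homogenize charK0 L1_neq0 q0 szq hq.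
  by rewrite eqr_oppLR -scaleNr => /eqP L2E; exists (- c).
have <- : (phi L)`_N.+1 = 0 by rewrite on_level_line coefC.
rewrite coef_on_line_top ?szL // /homogenize.
under eq_bigr => k _ do rewrite coefq scaler_suml.
rewrite exchange_big /= big_seq_cond [RHS]big_seq_cond; apply: eq_bigr => m /andP[mL /eqP dm].
have le : (m i <= N.+1)%N by rewrite -dm degE // leq_addr.
rewrite (bigD1 (inord (m i))) //= inordK // eqxx mulr1 big1 ?addr0 => [|k k_neq].
  rewrite mul_mpolyC; congr (_ *: _); rewrite /mmap1 (bigD1 i) //=.
  rewrite (bigD1 j) 1?eq_sym //= big1 ?mulr1 => [|k /andP[ki kj]].
    by rewrite /v eqxx [j == i]eq_sym (negPf ij) eqxx -dm degE // addKn.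
  by rewrite (supp m).
case: eqP => [km|]; last by rewrite mulr0 scale0r.
by case/eqP: k_neq; apply: val_inj; rewrite /= inordK.
Qed.
End LevelLines.

(** * Nilpotent matrices with a zero lower right block *)

(** The matrix 1 - X M is invertible over R[X], so its determinant is a unit of
    R[X], that is a constant, and its value at 0 is 1. *)
Lemma det_nilpotent (R : idomainType) n (M : 'M[R]_n) :
  nilpotent_mx M -> \det (1%:M - 'X *: map_mx polyC M) = 1.
Proof.
case=> k Mk; set B := 'X *: map_mx polyC M.
have Bk : B ^+ k = 0.
  suff -> : B ^+ k = 'X^k *: map_mx polyC (M ^+ k) by rewrite Mk map_mx0 scaler0.
  elim: {Mk} k => [|k IH]; first by rewrite !expr0 scale1r map_mx1.
  by rewrite !exprS IH /B -mulmxE map_mxM -scalemxAl -scalemxAr scalerA.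
have unitD : \det (1%:M - B) \is a GRing.unit.
  have inv : (1%:M - B) *m (\sum_(i < k) B ^+ i) = 1%:M.
    by have := subrX1 B k; rewrite Bk sub0r => /(congr1 -%R); rewrite opprK -mulNr opprB.
  by apply/unitrPr; exists (\det (\sum_(i < k) B ^+ i)); rewrite -det_mulmx inv det1.
have := unitD; rewrite poly_unitE => /andP[/eqP sz1 _].
rewrite (@size1_polyC _ (\det _)) ?sz1 // -horner_coef0.
rewrite -[_.[0]]/(horner_eval 0 _) -det_map_mx map_mxB map_mx1.
suff -> : map_mx (horner_eval 0) B = 0 by rewrite subr0 det1.
by apply/matrixP => i j; rewrite !mxE /horner_eval hornerM hornerX mul0r.
Qed.

Lemma det_arrow (R : comNzRingType) m (A : 'M[R]_2) (B : 'M[R]_(2, m)) (C : 'M[R]_(m, 2)) :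
  \det (block_mx A B C 1%:M) = \det (A - B *m C).
Proof.
have : block_mx A B C 1%:M *m block_mx 1%:M 0 (- C) 1%:M
    = block_mx (A - B *m C) B 0 1%:M.
  by rewrite mulmx_block !mulmx1 !mulmx0 mul1mx !add0r mulmxN subrr.
move/(congr1 determinant); rewrite det_mulmx det_lblock det_ublock !det1 !mulr1.
by [].
Qed.

Lemma det_mx2 (R : comNzRingType) (A : 'M[R]_2) :
  \det A = A ord0 ord0 * A ord_max ord_max - A ord0 ord_max * A ord_max ord0.
Proof.
rewrite (expand_det_row A ord0) !big_ord_recl big_ord0 /cofactor !det_mx11 !mxE /= addr0.
have -> : lift ord0 ord0 = ord_max :> 'I_2 by apply: val_inj.
have -> : lift ord_max ord0 = ord0 :> 'I_2 by apply: val_inj.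
by rewrite expr0 mul1r expr1 mulN1r mulrN.
Qed.

Lemma det2_pencil_eq1 (R : comNzRingType) (a b c d p q r s : R) :
    (1 - 'X * a%:P - 'X ^+ 2 * p%:P) * (1 - 'X * d%:P - 'X ^+ 2 * s%:P)
    - ('X * b%:P + 'X ^+ 2 * q%:P) * ('X * c%:P + 'X ^+ 2 * r%:P) = 1 ->
  [/\ a + d = 0, a * d - b * c = p + s,
      a * s + p * d = b * r + q * c & p * s = q * r].
Proof.
set lhs := (X in X = 1) => lhs1.
have : Poly [:: 0; a + d; p + s - (a * d - b * c);
    b * r + q * c - (a * s + p * d); q * r - p * s] = 0.
  rewrite /= !cons_poly_def mul0r add0r !(polyCD, polyCB, polyCM) polyC0.
  apply: (etrans (_ : _ = 1 - lhs)); last by rewrite lhs1 subrr.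
  by rewrite /lhs; ring.
move=> P0; have coefP k : (Poly [:: 0; a + d; p + s - (a * d - b * c);
    b * r + q * c - (a * s + p * d); q * r - p * s])`_k = 0 by rewrite P0 coef0.
have := (coefP 1%N, coefP 2%N, coefP 3%N, coefP 4%N); rewrite !coef_Poly /=.
move=> [[[e1 e2] e3] e4]; split=> //.
- by apply/esym/eqP; rewrite -subr_eq0 e2.
- by apply/esym/eqP; rewrite -subr_eq0 e3.
- by apply/esym/eqP; rewrite -subr_eq0 e4.
Qed.

(** By the Schur complement, det (1 - X M) is the determinant of the 2 x 2 matrix
    1 - X A - X^2 E, where A is the upper left block of M and E the product of
    its off-diagonal blocks. The four equations are its coefficients. *)
Lemma nilpotent_arrow_eqs (R : idomainType) n (i1 i2 : 'I_n) (M : 'M[R]_n) :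
    i1 = 0%N :> nat -> i2 = 1%N :> nat ->
    (forall i j : 'I_n, (1 < i)%N -> (1 < j)%N -> M i j = 0) ->
    nilpotent_mx M ->
  let E i j := \sum_(k < n | (1 < k)%N) M i k * M k j in
  [/\ M i1 i1 + M i2 i2 = 0,
      M i1 i1 * M i2 i2 - M i1 i2 * M i2 i1 = E i1 i1 + E i2 i2,
      M i1 i1 * E i2 i2 + E i1 i1 * M i2 i2
        = M i1 i2 * E i2 i1 + E i1 i2 * M i2 i1
    & E i1 i1 * E i2 i2 = E i1 i2 * E i2 i1].
Proof.
move=> i1E i2E; have : (1 < n)%N by rewrite -i2E ltn_ord.
case: n i1 i2 M i1E i2E => [|[|m]] // i1 i2 M i1E i2E _ M0 nilM E.
apply: det2_pencil_eq1; rewrite -[RHS](det_nilpotent nilM).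
change m.+2 with (2 + m)%N in *.
have i1L : i1 = lshift m ord0 by apply: val_inj.
have i2L : i2 = lshift m ord_max by apply: val_inj.
have EE i j : E i j = \sum_(k < m) M i (rshift 2 k) * M (rshift 2 k) j.
  rewrite /E big_mkcond big_split_ord /= big1 ?add0r => [|k _]; last first.
    by rewrite ltnNge -ltnS ltn_ord.
  by apply: eq_bigr.
set N := 1%:M - _.
have -> : N = block_mx (ulsubmx N) (ursubmx N) (dlsubmx N) 1%:M.
  rewrite -{1}[N]submxK; congr block_mx; apply/matrixP => i j.
  by rewrite !mxE M0 //= mulr0 subr0.
rewrite det_arrow det_mx2 !mxE -i1L -i2L.
have BC a b : \sum_j ursubmx N a j * dlsubmx N j b
    = 'X ^+ 2 * (E (lshift m a) (lshift m b))%:P.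
  rewrite EE rmorph_sum mulr_sumr; apply: eq_bigr => k _; rewrite !mxE.
  rewrite eq_lrshift eq_rlshift !sub0r mulrNN rmorphM expr2.
  by rewrite mulrACA.
rewrite !BC -i1L -i2L !eqxx [i2 == i1]eq_sym.
have -> : (i1 == i2) = false by rewrite -val_eqE /= i1E i2E.
by rewrite !sub0r -!opprD mulrNN.
Qed.

(** * The plane system for L and P *)

(** Used for D_1 L = 0, with s for D_2 L: if f <> 0, the second equation makes
    p equal to s, so s^2 = 0, and then f^2 = 0. *)
Lemma degenerate_traces (R : idomainType) (f s p : R) :
  p = - (f * f) - s -> f * (f * f + 2%:R * s) = 0 -> p * s = 0 -> s = 0 /\ f = 0.
Proof.
have mul0P (u v : R) : u * v = 0 -> u = 0 \/ v = 0.
  by move/eqP; rewrite mulf_eq0 => /orP[] /eqP; [left | right].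
move=> p_sf /mul0P[f0|f_s] ps.
  move: ps; rewrite p_sf f0 mul0r oppr0 sub0r mulNr => /eqP.
  by rewrite oppr_eq0 => /eqP/mul0P[] ->.
have pE : p = s by apply: eq_from_sub (esym f_s); rewrite p_sf; ring.
have s0 : s = 0 by move: ps; rewrite pE => /mul0P[].
by split=> //; move: f_s; rewrite s0 mulr0 addr0 => /mul0P[].
Qed.

Section PlaneSystem.
Variables (K : fieldType) (n : nat).
Hypothesis charK0 : [pchar K] =i pred0.
Variables (i j : 'I_n).

Let nat_neq0 k : (k.+1%:R : {mpoly K[n]}) != 0.
Proof.
rewrite (iffLR (pcharf0P _)) // => l.
by rewrite (pchar_lalg {mpoly K[n]}).
Qed.

(** Here r, s, p, q stand for the partial derivatives of L and of P.
    Eliminating p and s shows r * w = f^6 for a polynomial w, so r and w do not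
    involve the i-th variable. The i-derivatives of the equation for a r, of
    r * w = f^6, and of what results from the latter, give in turn [fr], [fq] and
    [ff]; eliminating f from [fr] and [ff] leaves r r'' = 2 r'^2 in the j-th
    variable. *)
Lemma plane_system_rigid (f a r s p q : {mpoly K[n]}) :
    f != 0 -> r != 0 ->
    f^`M(i) = 0 -> a^`M(i) = - f^`M(j) ->
    r^`M(j) = s^`M(i) -> p^`M(j) = q^`M(i) ->
    p = - (f * f) - s -> a * r = - (f * (f * f + 2%:R * s)) -> p * s = q * r ->
  [/\ r^`M(i) = 0, r^`M(j) = 0, s^`M(j) = 0 & f^`M(j) = 0].
Proof.
move=> f_neq0 r_neq0 Dfi Da rs pq p_sf a_r p_s.
pose w := 4%:R * f * f * q + a * a * r.
pose f6 := f * f * f * (f * f * f).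
have f6_neq0 : f6 != 0 by rewrite !mulf_neq0.
have Df6 : f6^`M(i) = 0 by rewrite !mderivM Dfi; ring.
have rw : r * w = f6.
  have -> : r * w = 4%:R * f * f * (q * r) + (a * r) * (a * r) by rewrite /w; ring.
  by rewrite -p_s a_r p_sf /f6; ring.
have Dr : r^`M(i) = 0 by apply: (mderiv_factor charK0 rw).
have wr : w * r = f6 by rewrite mulrC.
have Dw : w^`M(i) = 0 by apply: (mderiv_factor charK0 wr).
have fr : f^`M(j) * r = 2%:R * f * r^`M(j).
  apply: eq_from_sub (congr1 (mderiv i) (esym a_r)).
  rewrite !(mderivM, mderivN, mderivD, mderiv_nat) Dr Da Dfi -rs; ring.
have fq : 2%:R * f * f * (- (2%:R * f * f^`M(j)) - s^`M(j)) = a * f^`M(j) * r.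
  have q_i : q^`M(i) = - (2%:R * f * f^`M(j)) - s^`M(j).
    by rewrite -pq p_sf mderivB mderivN mderivM; ring.
  apply: (mulfI (nat_neq0 1)); apply: eq_from_sub Dw.
  by rewrite -q_i /w !(mderivM, mderivD, mderiv_nat) Dr Da Dfi; ring.
have ff : 2%:R * f * f * r^`M(j)^`M(j) = f^`M(j) * f^`M(j) * r.
  apply: eq_from_sub (congr1 (mderiv i) (esym fq)).
  rewrite !(mderivM, mderivN, mderivD, mderivB, mderiv_nat) Dr Da Dfi.
  rewrite [f^`M(j)^`M(i)]mderiv_comm Dfi [s^`M(j)^`M(i)]mderiv_comm -rs mderiv0; ring.
have Drj : r^`M(j) = 0.
  apply: (mderiv_square charK0); apply: (@mulfI _ (2%:R * f * f)).
    by rewrite !mulf_neq0.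
  have -> : 2%:R * f * f * (r * r^`M(j)^`M(j)) = (f^`M(j) * r) * (f^`M(j) * r).
    by rewrite mulrCA ff; ring.
  by rewrite fr; ring.
have Dfj : f^`M(j) = 0.
  by move/eqP: fr; rewrite Drj mulr0 mulf_eq0 (negPf r_neq0) orbF => /eqP.
split=> //; move/eqP: fq.
rewrite Dfj !(mulr0, mul0r) oppr0 add0r mulrN oppr_eq0 !mulf_eq0.
by rewrite (negPf (nat_neq0 1)) (negPf f_neq0) => /eqP.
Qed.

(** Here the Jacobian matrix of (P, L) has trace and determinant zero.
    Differentiating the determinant and eliminating P gives the flatness of L. *)
Lemma plane_system_flat (L P : {mpoly K[n]}) :
    i != j -> in_vars [set i; j] L -> in_vars [set i; j] P ->
    L.@[fun=> 0] = 0 -> P.@[fun=> 0] = 0 -> L^`M(i) != 0 ->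
    P^`M(i) = - L^`M(j) -> P^`M(i) * L^`M(j) = P^`M(j) * L^`M(i) ->
  exists c : K, L^`M(j) = c *: L^`M(i) /\ P = - c *: L.
Proof.
move=> ij LV PV L0 P0 Li_neq0 Pi PjLi.
have Dk (p : {mpoly K[n]}) k : in_vars [set i; j] p -> k != i -> k != j -> p^`M(k) = 0.
  by move=> pV ki kj; apply: in_vars_mderiv pV _; rewrite !inE negb_or ki.
have flat : L^`M(i) * L^`M(i) * L^`M(j)^`M(j)
    - 2%:R * L^`M(i) * L^`M(j) * L^`M(i)^`M(j)
    + L^`M(j) * L^`M(j) * L^`M(i)^`M(i) = 0.
  have Pij : P^`M(j)^`M(i) = - L^`M(j)^`M(j) by rewrite mderiv_comm Pi mderivN.
  move: PjLi; rewrite Pi => E; have E1 := congr1 (mderiv i) E; move: E E1.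
  rewrite !(mderivM, mderivN) Pij [L^`M(j)^`M(i)]mderiv_comm.
  move: (L^`M(i)) (L^`M(j)) (P^`M(j)) => x y z.
  move=> /eqP; rewrite -subr_eq0 => /eqP E /eqP; rewrite -subr_eq0 => /eqP E1.
  by rewrite -[RHS]subr0 -{1}(mulr0 x) -{1}E1 -(mulr0 x^`M(i)) -E; ring.
have [c Lj] := proportional_partials charK0 ij (fun k => Dk L k LV) Li_neq0 flat.
exists c; split=> //; apply: (eq_mderiv charK0) => [k|]; last by rewrite mevalZ L0 P0 mulr0.
rewrite mderivZ; have [->|ki] := eqVneq k i; first by rewrite Pi Lj scaleNr.
have [->|kj] := eqVneq k j; last by rewrite !Dk ?scaler0.
apply: (mulIf Li_neq0); rewrite -PjLi Pi Lj -!mul_mpolyC mpolyCN; ring.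
Qed.

(** The three equations express what the factorization of F into shears
    needs: for N with gradient (- D_i L, f - D_j L), the first says that N is a
    polynomial in x_i + k x_j, and the other two say that the first component of F has
    the derivatives in x_i and x_j that the factorization gives it. *)
Lemma plane_system_shears (f a L P : {mpoly K[n]}) :
    i != j -> in_vars [set j] f -> in_vars [set i; j] a ->
    in_vars [set i; j] L -> in_vars [set i; j] P ->
    L.@[fun=> 0] = 0 -> P.@[fun=> 0] = 0 -> L^`M(i) != 0 ->
    a^`M(i) = - f^`M(j) ->
    P^`M(i) = - (f * f) - L^`M(j) ->
    a * L^`M(i) = - (f * (f * f + 2%:R * L^`M(j))) ->
    P^`M(i) * L^`M(j) = P^`M(j) * L^`M(i) ->
  exists k k' : K,
    [/\ f - L^`M(j) = - (k *: L^`M(i)),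
        - f = P^`M(i) - k' *: L^`M(i)
      & a = k%:MP + k' *: (1 + f - L^`M(j)) + P^`M(j)].
Proof.
move=> ij fV aV LV PV L0 P0 Li_neq0 Da trace2 trace3 trace4.
have [f0|f_neq0] := eqVneq f 0.
  (* then a = 0 and P = - c L, where c is the slope of the level lines *)
  rewrite f0 !mul0r oppr0 in trace2 trace3; rewrite sub0r in trace2.
  have a0 : a = 0 by move/eqP: trace3; rewrite mulf_eq0 (negPf Li_neq0) orbF => /eqP.
  have [c [Lj PL]] := plane_system_flat ij LV PV L0 P0 Li_neq0 trace2 trace4.
  exists c, (- c); rewrite f0 a0 PL !mderivZ Lj.
  split; rewrite -?mul_mpolyC ?mpolyCN; ring.
have Dk (p : {mpoly K[n]}) k : in_vars [set i; j] p -> k != i -> k != j -> p^`M(k) = 0.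
  by move=> pV ki kj; apply: in_vars_mderiv pV _; rewrite !inE negb_or ki.
have Df k : k != j -> f^`M(k) = 0 by move=> kj; apply: in_vars_mderiv fV _; rewrite inE.
have [Lii Lij Ljj Dfj] := plane_system_rigid f_neq0 Li_neq0 (Df i ij) Da
  (mderiv_comm _ _ _) (mderiv_comm _ _ _) trace2 trace3 trace4.
have Df0 k : f^`M(k) = 0 by have [->|/Df] := eqVneq k j.
have DDk (p : {mpoly K[n]}) k l : in_vars [set i; j] p -> k != i -> k != j -> p^`M(l)^`M(k) = 0.
  by move=> pV ki kj; rewrite mderiv_comm (Dk p) // mderiv0.
have DLi k : L^`M(i)^`M(k) = 0.
  have [->|ki] := eqVneq k i; first exact: Lii.
  by have [->|kj] := eqVneq k j; [exact: Lij | exact: DDk].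
have DLj k : L^`M(j)^`M(k) = 0.
  have [->|ki] := eqVneq k i; first by rewrite mderiv_comm.
  by have [->|kj] := eqVneq k j; [exact: Ljj | exact: DDk].
have DPi k : P^`M(i)^`M(k) = 0.
  by rewrite trace2 mderivB mderivN mderivM Df0 DLj; ring.
have mulDr0 (u : {mpoly K[n]}) k : (u * L^`M(i))^`M(k) = 0 -> u^`M(k) = 0.
  rewrite mderivM DLi mulr0 addr0 => /eqP.
  by rewrite mulf_eq0 (negPf Li_neq0) orbF => /eqP.
have DPj k : P^`M(j)^`M(k) = 0.
  by apply: mulDr0; rewrite -trace4 mderivM DPi DLj; ring.
have Dak k : a^`M(k) = 0.
  by apply: mulDr0; rewrite trace3 mderivN mderivM mderivD !mderivM mderiv_nat Df0 DLj; ring.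
(* all polynomials in the system are constants; k and k' solve the first two
   equations over K, and the third follows *)
move: (mderiv_eq0_const charK0 Df0) (mderiv_eq0_const charK0 Dak)
  (mderiv_eq0_const charK0 DLi) (mderiv_eq0_const charK0 DLj)
  (mderiv_eq0_const charK0 DPi) (mderiv_eq0_const charK0 DPj).
move: f.@[_] a.@[_] L^`M(i).@[_] L^`M(j).@[_] P^`M(i).@[_] P^`M(j).@[_].
move=> f' a' r s p q fE aE rE sE pE qE.
move: trace2 trace3 trace4 Li_neq0; rewrite {}fE {}aE {}rE {}sE {}pE {}qE.
rewrite -mpolyC_nat -!(mpolyCN, mpolyCM, mpolyCB, mpolyCD) mpolyC_eq0.
have mpolyC_inj : injective (@mpolyC n K) by move=> x y /eqP; rewrite mpolyC_eq => /eqP.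
move=> /mpolyC_inj p_sf /mpolyC_inj a_r /mpolyC_inj p_s r_neq0.
exists ((s - f') / r), ((f' + p) / r); rewrite -!mul_mpolyC.
split; rewrite -!(mpolyCN, mpolyCM, mpolyCB, mpolyCD); congr mpolyC; apply: (mulIf r_neq0).
- by field.
- by field.
- transitivity ((s - f') + (f' + p) * (1 + f' - s) + q * r); last by field.
  by rewrite a_r -p_s p_sf; ring.
Qed.
End PlaneSystem.

(** * Tame maps *)

Section Tame.
Variables (K : fieldType) (n : nat).
Implicit Types (F G : polymap K n) (p : {mpoly K[n]}) (S V : {set 'I_n}).

Lemma comp_mpoly_comp p F G :
  comp_mpoly G (comp_mpoly F p) = comp_mpoly (polymap_comp F G) p.
Proof.
rewrite [comp_mpoly F p]comp_mpolyEX [RHS]comp_mpolyEX raddf_sum.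
apply: eq_bigr => m _ /=; rewrite comp_mpolyZ !comp_mpolyX rmorph_prod.
by congr (_ *: _); apply: eq_bigr => i _; rewrite rmorphXn tnth_mktuple.
Qed.

Lemma comp_mpoly_fix V p G : in_vars V p ->
  (forall i, i \in V -> tnth G i = 'X_i) -> comp_mpoly G p = p.
Proof.
move=> pV GX; rewrite comp_mpolyEX [RHS]mpolyE; apply: eq_big_seq => m mp.
rewrite comp_mpolyX mpolyXE_id; congr (_ *: _); apply: eq_bigr => i _.
by have [->|mi] := eqVneq (m i) 0%N; rewrite ?expr0 // GX // (pV m).
Qed.

Lemma tame_comp F G : tame F -> tame G -> tame (polymap_comp F G).
Proof.
move=> [s sF ->] [t tG ->]; exists (s ++ t) => [E|].
  by rewrite mem_cat => /orP[/sF|/tG].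
elim: s {sF} => [|E s IH] /=.
  by apply: eq_from_tnth => i; rewrite !tnth_mktuple [LHS]comp_mpolyXU -tnth_nth.
rewrite -IH; apply: eq_from_tnth => i.
by rewrite !tnth_mktuple comp_mpoly_comp.
Qed.

Lemma tame_elementary F : elementary F -> tame F.
Proof.
move=> elF; exists [:: F] => [G|/=]; first by rewrite inE => /eqP ->; right.
by apply: eq_from_tnth => i; rewrite tnth_mktuple /polymap_id comp_mpoly_id.
Qed.

Definition shift_map S (Q : 'I_n -> {mpoly K[n]}) : polymap K n :=
  [tuple if i \in S then 'X_i + Q i else 'X_i | i < n].

(** The variables in S can be shifted one after the other, since no Q i involves
    a variable that has already been changed. *)
Lemma tame_shift_map S Q : (forall i, i \in S -> in_vars (~: S) (Q i)) ->
  tame (shift_map S Q).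
Proof.
move: {2}#|S| (erefl #|S|) => k; elim: k S => [|k IH] S cardS QS.
  have {cardS} S0 : S = set0 by apply/eqP; rewrite -cards_eq0 cardS.
  exists [::] => //; apply: eq_from_tnth => i.
  by rewrite !tnth_mktuple S0 inE.
have [i iS] : exists i, i \in S by apply/set0Pn; rewrite -cards_eq0 cardS.
have QS' j : j \in S :\ i -> in_vars (~: (S :\ i)) (Q j).
  rewrite !inE => /andP[_ jS] m mQ l ml; have := QS j jS m mQ l ml.
  by rewrite !inE negb_and orbC => ->.
have {}/IH/(_ QS') IH : #|S :\ i| = k by move: (cardsD1 i S); rewrite iS cardS => -[].
have -> : shift_map S Q = polymap_comp (shift_map [set i] Q) (shift_map (S :\ i) Q).
  apply: eq_from_tnth => j; rewrite !tnth_mktuple !inE.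
  have [->|ji] := eqVneq j i; last by rewrite [RHS]comp_mpolyXU -tnth_nth tnth_mktuple !inE ji.
  rewrite iS raddfD /= comp_mpolyXU -tnth_nth tnth_mktuple !inE eqxx /=.
  congr (_ + _); rewrite (comp_mpoly_fix (QS i iS)) // => l; rewrite inE => lS.
  by rewrite tnth_mktuple !inE (negPf lS) andbF.
apply: tame_comp IH; apply: tame_elementary; exists i, (Q i).
  move=> m mQ l ml; have := QS i iS m mQ l ml.
  by rewrite !inE; apply: contraNneq => ->.
by apply: eq_from_tnth => j; rewrite !tnth_mktuple inE; case: eqP => // ->.
Qed.
End Tame.

Section TameCriterion.
Variables (K : fieldType) (n : nat).
Hypothesis charK0 : [pchar K] =i pred0.
Variables (i1 i2 : 'I_n) (H : polymap K n) (Z : {set 'I_n}).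
Hypothesis i12 : i1 != i2.
Hypothesis ZE : Z = ~: [set i1; i2].
Variables (b c : 'I_n -> K) (N : {mpoly K[n]}) (k k' : K).
Hypothesis HZ : forall j, j \in Z -> in_vars [set i1; i2] (tnth H j).
Hypothesis NV : in_vars [set i1; i2] N.
Hypothesis DN : N^`M(i2) = k *: N^`M(i1).
Hypothesis H1E : tnth H i1 = k *: 'X_i2 + k' *: ('X_i2 + N)
  + \sum_(j in Z) c j *: ('X_j + tnth H j).
Hypothesis H2E : tnth H i2 = N + \sum_(j in Z) b j *: ('X_j + tnth H j).

Let shear (a : K) : polymap K n := shift_map [set i1] (fun=> a *: 'X_i2).

Lemma tame_shear a : tame (shear a).
Proof.
apply: tame_shift_map => i _; apply/(in_varsP charK0) => j.
by rewrite !inE negbK => /eqP ->; rewrite mderivZ mderivXU eq_sym (negPf i12) scaler0.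
Qed.

Lemma comp_shear a a' p : comp_mpoly (shear a) (comp_mpoly (shear a') p)
  = comp_mpoly (shear (a + a')) p.
Proof.
rewrite comp_mpoly_comp; congr (comp_mpoly _ p).
apply: eq_from_tnth => i; rewrite !tnth_mktuple !inE.
have [->|ni] := eqVneq i i1.
  rewrite raddfD /= comp_mpolyZ !comp_mpolyXU -!tnth_nth !tnth_mktuple !inE eqxx.
  by rewrite eq_sym (negPf i12) scalerDl addrA.
by rewrite comp_mpolyXU -tnth_nth tnth_mktuple inE (negPf ni).
Qed.

(** The univariate polynomial B such that N = B(x_1 + k x_2). *)
Let N' := comp_mpoly (shear (- k)) N.

Lemma unshearK : comp_mpoly (shear k) N' = N.
Proof.
rewrite comp_shear subrr -[RHS]comp_mpoly_id; congr (comp_mpoly _ N).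
by apply: eq_from_tnth => i; rewrite !tnth_mktuple scale0r addr0 if_same.
Qed.

Lemma mderiv_unshear : N'^`M(i2) = 0.
Proof.
rewrite /N' /comp_mpoly.
rewrite (@mmap_chain_rule _ _ _ _ _ (mderiv i2)) /= => [|p q|a]; last 2 first.
- exact: mderivM.
- exact: mderivC.
rewrite (bigD1 i1) //= (bigD1 i2) 1?eq_sym //= big1 => [|j /andP[j1 j2]]; last first.
  by rewrite tnth_mktuple inE (negPf j1) mderivXU (negPf j2) mulr0.
rewrite !tnth_mktuple !inE eqxx [i2 == i1]eq_sym (negPf i12) mderivD mderivZ !mderivXU.
rewrite (negPf i12) eqxx add0r addr0 mulr1 DN mmapZ scaleNr -mul_mpolyC mulr1; ring.
Qed.

(** Reading the factors from the right: add H_j to x_j for j in Z, add k x_2 to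
    x_1, add N to x_2, add k' x_2 to x_1, and add linear forms in the x_j, j in Z,
    to x_1 and x_2. The last step also brings in the combinations of the H_j
    from the first one; the hypotheses on H_1 and H_2 account for them. *)
Lemma tame_of_shears : tame (polymap_add (polymap_id K n) H).
Proof.
pose E := shift_map Z (tnth H).
pose B := shift_map [set i2] (fun=> N').
pose A := shift_map [set i1; i2]
  (fun i => if i == i1 then \sum_(j in Z) c j *: 'X_j else \sum_(j in Z) b j *: 'X_j).
have tE : tame E.
  by apply: tame_shift_map => j jZ; rewrite ZE setCK; apply: HZ.
have tB : tame B.
  apply: tame_shift_map => j _; apply/(in_varsP charK0) => l.
  by rewrite !inE negbK => /eqP ->; apply: mderiv_unshear.
have tA : tame A.
  apply: tame_shift_map => j _; apply/(in_varsP charK0) => l; rewrite -ZE => lZ.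
  by case: eqP => _; rewrite mderiv_linear_form (negPf lZ).
suff -> : polymap_add (polymap_id K n) H
    = polymap_comp A (polymap_comp (shear k') (polymap_comp B (polymap_comp (shear k) E))).
  by do !apply: tame_comp => //; apply: tame_shear.
set W := polymap_comp (shear k) E.
have i1Z : i1 \notin Z by rewrite ZE !inE eqxx.
have i2Z : i2 \notin Z by rewrite ZE !inE eqxx orbT.
have compX G i : comp_mpoly G 'X_i = tnth G i :> {mpoly K[n]}.
  by rewrite comp_mpolyXU -tnth_nth.
have i21 : (i2 == i1) = false by rewrite eq_sym (negPf i12).
have W1 : tnth W i1 = 'X_i1 + k *: 'X_i2.
  rewrite !tnth_mktuple inE eqxx raddfD /= comp_mpolyZ !compX !tnth_mktuple.
  by rewrite (negPf i1Z) (negPf i2Z).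
have W2 : tnth W i2 = 'X_i2.
  by rewrite !tnth_mktuple inE i21 compX tnth_mktuple (negPf i2Z).
have WZ j : j \in Z -> tnth W j = 'X_j + tnth H j.
  move=> jZ; rewrite !tnth_mktuple inE; case: eqP => [j1|_].
    by rewrite j1 (negPf i1Z) in jZ.
  by rewrite compX tnth_mktuple jZ.
have WN : comp_mpoly W N' = N.
  rewrite -comp_mpoly_comp unshearK; apply: comp_mpoly_fix NV _ => j.
  by rewrite !inE tnth_mktuple ZE !inE => ->.
set V := polymap_comp B W.
have V1 : tnth V i1 = 'X_i1 + k *: 'X_i2.
  by rewrite tnth_mktuple tnth_mktuple inE (negPf i12) compX W1.
have V2 : tnth V i2 = 'X_i2 + N.
  by rewrite tnth_mktuple tnth_mktuple inE eqxx raddfD /= compX W2 WN.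
have VZ j : j \in Z -> tnth V j = 'X_j + tnth H j.
  move=> jZ; rewrite tnth_mktuple tnth_mktuple inE; case: eqP => [j2|_].
    by rewrite j2 (negPf i2Z) in jZ.
  by rewrite compX WZ.
set U := polymap_comp (shear k') V.
have U1 : tnth U i1 = 'X_i1 + k *: 'X_i2 + k' *: ('X_i2 + N).
  by rewrite tnth_mktuple tnth_mktuple inE eqxx raddfD /= comp_mpolyZ !compX V1 V2.
have U2 : tnth U i2 = 'X_i2 + N.
  by rewrite tnth_mktuple tnth_mktuple inE i21 compX V2.
have UZ j : j \in Z -> tnth U j = 'X_j + tnth H j.
  move=> jZ; rewrite tnth_mktuple tnth_mktuple inE; case: eqP => [j1|_].
    by rewrite j1 (negPf i1Z) in jZ.
  by rewrite compX VZ.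
have linU (a : 'I_n -> K) : comp_mpoly U (\sum_(j in Z) a j *: 'X_j)
    = \sum_(j in Z) a j *: ('X_j + tnth H j).
  rewrite raddf_sum; apply: eq_bigr => j jZ /=.
  by rewrite comp_mpolyZ compX UZ.
apply: eq_from_tnth => i; rewrite [LHS]tnth_mktuple [RHS]tnth_mktuple !tnth_mktuple !inE.
have [->|n1] := eqVneq i i1.
  by rewrite raddfD /= compX U1 linU H1E !addrA.
have [->|n2] /= := eqVneq i i2.
  by rewrite raddfD /= compX U2 linU H2E !addrA.
have iZ : i \in Z by rewrite ZE !inE (negPf n1) (negPf n2).
by rewrite compX UZ.
Qed.
End TameCriterion.

(** * The theorem *)

(* Indices are shifted by one: i1 and i2 are the positions of x_1 and x_2. *)
Theorem corollary3p4 (K : fieldType) (charK0 : [pchar K] =i pred0)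
    (n : nat) (n_ge3 : (3 <= n)%N)
    (i1 i2 : 'I_n) (i1E : nat_of_ord i1 = 0%N) (i2E : nat_of_ord i2 = 1%N)
    (H : polymap K n)
    (H_at0 : forall i : 'I_n, (tnth H i).@[fun _ : 'I_n => 0] = 0)
    (b : 'I_n -> K) (H20 : {mpoly K[n]}) (H20_vars : in_vars [set i2] H20)
    (H2E : tnth H i2 = \sum_(j < n | (1 < j)%N) b j *: 'X_j + H20)
    (Hrest_vars : forall i : 'I_n, (1 < i)%N -> in_vars [set i1; i2] (tnth H i))
    (JH_nilp : nilpotent_mx (jacobian H))
    (H_indep : lin_indep H) :
  tame (polymap_add (polymap_id K n) H).
Proof.
have i12 : i1 != i2 by rewrite -val_eqE /= i1E i2E.
pose Z := [set j : 'I_n | (1 < j)%N].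
have ZE : Z = ~: [set i1; i2].
  apply/setP => j; rewrite !inE -!val_eqE /= i1E i2E.
  by case: (j : nat) => [|[|]].
have inZ j : (j \in Z) = (1 < j)%N by rewrite inE.
have i1Z : i1 \notin Z by rewrite inE i1E.
have i2Z : i2 \notin Z by rewrite inE i2E.
have VZ j : (j \notin [set i1; i2]) = (j \in Z) by rewrite ZE in_setC.
have Hvars j : j \in Z -> in_vars [set i1; i2] (tnth H j).
  by rewrite inE; apply: Hrest_vars.
have H2Z : tnth H i2 = \sum_(j in Z) b j *: 'X_j + H20.
  by rewrite H2E; congr (_ + _); apply: eq_bigl => j; rewrite inE.
pose f := H20^`M(i2).
have Df k : k != i2 -> H20^`M(k) = 0 by move=> k2; apply: in_vars_mderiv H20_vars _; rewrite inE.
have fV : in_vars [set i2] f.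
  apply/(in_varsP charK0) => k; rewrite inE => k2.
  by rewrite /f mderiv_comm Df // mderiv0.
have DH2 k : (tnth H i2)^`M(k) = (if k \in Z then (b k)%:MP else 0) + H20^`M(k).
  by rewrite H2Z mderivD mderiv_linear_form.
have DH20Z k : k \in Z -> H20^`M(k) = 0.
  by move=> kZ; apply: Df; apply: contraNneq i2Z => <-.
have indepZ (c : 'I_n -> K) : \sum_(j in Z) c j *: tnth H j = 0 ->
    forall j, j \in Z -> c j = 0.
  move=> rel j jZ; have := H_indep (fun j => if j \in Z then c j else 0) _ j.
  rewrite jZ; apply; rewrite -[RHS]rel [RHS]big_mkcond; apply: eq_bigr => l _.
  by case: ifP; rewrite ?scale0r.
pose L := \sum_(j in Z) b j *: tnth H j.
have LV : in_vars [set i1; i2] L by apply: in_vars_lincomb.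
have L0 : L.@[fun=> 0] = 0 by apply: meval0_lincomb => j _; apply: H_at0.
pose a := (tnth H i1)^`M(i2).
pose p := \sum_(j in Z) (tnth H i1)^`M(j) * (tnth H j)^`M(i1).
pose q := \sum_(j in Z) (tnth H i1)^`M(j) * (tnth H j)^`M(i2).
have [tr1 tr2 tr3 tr4] : [/\ (tnth H i1)^`M(i1) = - f,
    p = - (f * f) - L^`M(i2),
    a * L^`M(i1) = - (f * (f * f + 2%:R * L^`M(i2)))
  & p * L^`M(i2) = q * L^`M(i1)].
  have JZ (j k : 'I_n) : (1 < j)%N -> (1 < k)%N -> jacobian H j k = 0.
    rewrite -!inZ => jZ kZ; rewrite mxE.
    by apply: in_vars_mderiv (Hvars j jZ) _; rewrite VZ.
  have := nilpotent_arrow_eqs i1E i2E JZ JH_nilp.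
  have E1 i : \sum_(k < n | (1 < k)%N) jacobian H i1 k * jacobian H k i
      = \sum_(j in Z) (tnth H i1)^`M(j) * (tnth H j)^`M(i).
    by apply: eq_big => [k|k _]; rewrite ?inZ // !mxE.
  have E2 i : \sum_(k < n | (1 < k)%N) jacobian H i2 k * jacobian H k i = L^`M(i).
    rewrite raddf_sum; apply: eq_big => [k|k]; rewrite ?inZ // -inZ => kZ.
    by rewrite !mxE DH2 kZ DH20Z // addr0 /= mderivZ mul_mpolyC.
  rewrite /= !E1 !E2 -/p -/q !mxE -/a !DH2 (negPf i1Z) (negPf i2Z) !add0r -/f (Df i1) //.
  move: (_^`M(i1)) (L^`M(i1)) (L^`M(i2)) => x r s [e1 e2 e3 e4].
  have xE : x = - f by apply/eqP; rewrite -addr_eq0 e1.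
  have pE : p = - (f * f) - s.
    by apply: eq_from_sub (esym e2); rewrite xE; ring.
  split=> //; apply: eq_from_sub (esym e3); rewrite xE pE; ring.
(* otherwise L, hence b, hence H_2 vanishes *)
have L1_neq0 : L^`M(i1) != 0.
  apply/eqP => L1; rewrite L1 !mulr0 in tr3 tr4.
  have [s0 f0] : L^`M(i2) = 0 /\ f = 0.
    by apply: degenerate_traces tr2 _ tr4; apply: oppr_inj; rewrite -tr3 oppr0.
  have Lconst : L = 0.
    apply: (eq_mderiv charK0) => [k|]; last by rewrite L0 meval0.
    rewrite mderiv0; have [->//|k1] := eqVneq k i1; have [->//|k2] := eqVneq k i2.
    by apply: in_vars_mderiv LV _; rewrite !inE negb_or k1.
  have b0 := indepZ b Lconst.
  have H2H20 : tnth H i2 = H20.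
    by rewrite H2Z big1 ?add0r // => j jZ; rewrite b0 // scale0r.
  have H20_eq0 : H20 = 0.
    apply: (eq_mderiv charK0) => [k|]; last by rewrite -H2H20 H_at0 meval0.
    by rewrite mderiv0; have [->//|/Df] := eqVneq k i2.
  have rel : \sum_j (j == i2)%:R *: tnth H j = 0.
    rewrite (bigD1 i2) //= H2H20 H20_eq0 scaler0 add0r big1 // => j /negPf ->.
    by rewrite scale0r.
  by have := H_indep _ rel i2; rewrite eqxx => /eqP; rewrite oner_eq0.
(* f and L do not involve z, so neither does p, nor do a and q, whose products
   with D_1 L are polynomials in f, p and the partial derivatives of L *)
have DL k l : k \in Z -> L^`M(l)^`M(k) = 0.
  by move=> kZ; rewrite mderiv_comm (in_vars_mderiv LV) ?mderiv0 ?VZ.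
have DfZ k : k \in Z -> f^`M(k) = 0.
  by move=> kZ; rewrite /f mderiv_comm DH20Z // mderiv0.
have DmulL u k : k \in Z -> (u * L^`M(i1))^`M(k) = 0 -> u^`M(k) = 0.
  move=> kZ; rewrite mderivM DL // mulr0 addr0 => /eqP.
  by rewrite mulf_eq0 (negPf L1_neq0) orbF => /eqP.
have DaZ k : k \in Z -> a^`M(k) = 0.
  move=> kZ; apply: (DmulL _ _ kZ).
  by rewrite tr3 mderivN mderivM mderivD !mderivM mderiv_nat DfZ // DL //; ring.
have DpZ k : k \in Z -> p^`M(k) = 0.
  by move=> kZ; rewrite tr2 mderivB mderivN mderivM DfZ // DL //; ring.
have DqZ k : k \in Z -> q^`M(k) = 0.
  by move=> kZ; apply: (DmulL _ _ kZ); rewrite -tr4 mderivM DpZ // DL //; ring.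
(* H_1 has no second derivatives in z *)
have DHZ j k l : j \in Z -> k \in Z -> (tnth H j)^`M(l)^`M(k) = 0.
  by move=> jZ kZ; rewrite mderiv_comm (in_vars_mderiv (Hvars j jZ)) ?mderiv0 ?VZ.
have D3 j k l : (tnth H i1)^`M(j)^`M(k)^`M(l) = (tnth H i1)^`M(l)^`M(j)^`M(k).
  by rewrite (mderiv_comm k) (mderiv_comm j).
have hess0 j k : j \in Z -> k \in Z -> (tnth H i1)^`M(j)^`M(k) = 0.
  move=> jZ kZ; move: j jZ.
  apply: (@separated_relation _ _ charK0 _ (fun j => j \in Z) [set i1; i2] (fun j => tnth H j)) => //.
    move=> j jZ; apply/(in_varsP charK0) => l.
    rewrite in_setC negbK !inE D3 => /orP[] /eqP ->.
      by rewrite tr1 mderivN DfZ // oppr0 mderiv0.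
    by rewrite -/a DaZ // mderiv0.
  have Dsum l : (\sum_(j in Z) (tnth H i1)^`M(j) * (tnth H j)^`M(l))^`M(k) = 0 ->
      \sum_(j in Z) (tnth H i1)^`M(j)^`M(k) * (tnth H j)^`M(l) = 0.
    move=> rel; apply: etrans rel; rewrite raddf_sum; apply: eq_bigr => j jZ /=.
    by rewrite mderivM (DHZ j k) // mulr0 addr0.
  by move=> l; rewrite !inE => /orP[] /eqP ->; apply: Dsum; [apply: DpZ | apply: DqZ].
pose c j := ((tnth H i1)^`M(j)).@[fun=> 0].
have DH1Z j : j \in Z -> (tnth H i1)^`M(j) = (c j)%:MP.
  move=> jZ; apply: (mderiv_eq0_const charK0) => k.
  have [kZ|] := boolP (k \in Z); first exact: hess0.
  rewrite -VZ negbK !inE mderiv_comm => /orP[] /eqP ->; last exact: DaZ.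
  by rewrite tr1 mderivN DfZ ?oppr0.
pose P := \sum_(j in Z) c j *: tnth H j.
have PV : in_vars [set i1; i2] P by apply: in_vars_lincomb.
have P0 : P.@[fun=> 0] = 0 by apply: meval0_lincomb => j _; apply: H_at0.
have pE : p = P^`M(i1).
  by rewrite raddf_sum; apply: eq_bigr => j jZ /=; rewrite DH1Z // mderivZ mul_mpolyC.
have qE : q = P^`M(i2).
  by rewrite raddf_sum; apply: eq_bigr => j jZ /=; rewrite DH1Z // mderivZ mul_mpolyC.
have aV : in_vars [set i1; i2] a.
  by apply/(in_varsP charK0) => k; rewrite VZ; apply: DaZ.
have Da : a^`M(i1) = - f^`M(i2) by rewrite /a mderiv_comm tr1 mderivN.
rewrite pE in tr2 tr4; rewrite qE in tr4.
have [k [k' [sh1 sh2 sh3]]] :=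
  plane_system_shears charK0 i12 fV aV LV PV L0 P0 L1_neq0 Da tr2 tr3 tr4.
(* x_2 + N is the second component before the last factor, which adds to it the
   form b.z taken at z + H_z *)
pose N := H20 - L.
have NV : in_vars [set i1; i2] N.
  apply/(in_varsP charK0) => l; rewrite VZ => lZ; rewrite mderivB (in_vars_mderiv LV) ?VZ //.
  by rewrite DH20Z ?subr0.
have N1 : N^`M(i1) = - L^`M(i1) by rewrite mderivB Df ?sub0r.
have N2 : N^`M(i2) = f - L^`M(i2) by rewrite mderivB.
have Xsum_at0 (d : 'I_n -> K) : (\sum_(j in Z) d j *: 'X_j : {mpoly K[n]}).@[fun=> 0] = 0.
  by apply: meval0_lincomb => j _; rewrite mevalXU.
have splitZ (d : 'I_n -> K) : \sum_(j in Z) d j *: ('X_j + tnth H j)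
    = \sum_(j in Z) d j *: 'X_j + \sum_(j in Z) d j *: tnth H j.
  by rewrite -big_split; apply: eq_bigr => j _; rewrite scalerDr.
have H20_at0 : H20.@[fun=> 0] = 0.
  by have := H_at0 i2; rewrite H2Z mevalD Xsum_at0 add0r.
have N_at0 : N.@[fun=> 0] = 0 by rewrite mevalB H20_at0 L0 subr0.
have H20E : H20 = N + L by rewrite subrK.
clearbody N; apply: (@tame_of_shears _ _ charK0 i1 i2 H Z i12 ZE b c N k k') => //.
- by rewrite N1 N2 sh1 scalerN.
- rewrite splitZ -/P; apply: (eq_mderiv charK0) => [l|]; last first.
    by rewrite H_at0 !mevalD Xsum_at0 P0 !mevalZ !mevalD mevalXU N_at0 !(mulr0, addr0).
  rewrite !(mderivD, mderivZ) mderivXU.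
  have [->|l1] := eqVneq l i1.
    by rewrite eq_sym (negPf i12) tr1 N1 mderiv_linear_form (negPf i1Z) sh2 !(scaler0, addr0, add0r) scalerN addrC.
  have [->|l2] := eqVneq l i2.
    rewrite N2 mderiv_linear_form (negPf i2Z) add0r -/a sh3. by rewrite /= !mulr1n -(mul_mpolyC k) mulr1 addrA.
  have lZ : l \in Z by rewrite -VZ !inE negb_or l1.
  have lV : l \notin [set i1; i2] by rewrite VZ.
  rewrite DH1Z // mderiv_linear_form lZ (in_vars_mderiv NV lV) (in_vars_mderiv PV lV).
  by rewrite /= !mulr0n !(scaler0, addr0, add0r).
- by rewrite splitZ -/L H2Z {1}H20E addrCA.
Qed.
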